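(* There is a monotonically shrinking temporal cycle $\mathcal{C}$ with lifetime $2$ such that there is no Nash equilibrium in the two-player temporal diffusion game $\mathrm{Diff}(\mathcal{C},2)$.
   Context: A temporal graph $\mathcal{G}=(V,(E_t)_{t=1}^\infty)$ consists of a finite vertex set $V$ and edge sets $E_t\subseteq\binom{V}{2}$; its $t$-th layer is $G_t=(V,E_t)$. Its lifetime is the least $\tau$ with $E_t=E_\tau$ for all $t\ge\tau$. The underlying graph is $(V,\bigcup_t E_t)$. A temporal cycle is a temporal graph whose underlying graph is a cycle. $\mathcal{G}$ is monotonically shrinking if $E_{t+1}\subseteq E_t$ for all $t$. Two-player temporal diffusion game $\mathrm{Diff}(\mathcal{G},2)$: players $1,2$ choose vertices $p_1,p_2\in V$ simultaneously. At time $0$, if $p_1\ne p_2$ then $p_i$ gets color $i$; if $p_1=p_2$ this vertex is colored gray. For $t=1,2,\dots$, in step $t$ each uncolored vertex having a neighbor in $G_t$ of color $i\in\{1,2\}$ and no neighbor in $G_t$ of the other player's color gets color $i$; each uncolored vertex having neighbors in $G_t$ of both colors $1$ and $2$ becomes gray. Gray does not spread, and colors never change. The payoff of player $i$ is the final number of vertices of color $i$. A profile $(p_1,p_2)$ is a Nash equilibrium if no player can strictly increase her payoff by unilaterally choosing another vertex. *)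

(* Defs.v *)
From mathcomp Require Import all_boot.
From mathcomp Require Import boolp.

Set Implicit Arguments.
Unset Strict Implicit.
Unset Printing Implicit Defensive.

(* Layers are numbered from 1: the value [edges 0] is never used. *)
Record temporal_graph (V : finType) := TemporalGraph {
  edges : nat -> {set {set V}};
  edges_card2 : forall t e, e \in edges t -> #|e| = 2
}.

Definition underlying_edge (V : finType) (G : temporal_graph V) (e : {set V}) :
    Prop :=
  exists2 t, 0 < t & e \in edges G t.

Definition is_lifetime (V : finType) (G : temporal_graph V) (tau : nat) : Prop :=
  let stable_from s := 0 < s /\ forall t, s <= t -> edges G t = edges G s in
  stable_from tau /\ forall s, stable_from s -> tau <= s.

Definition monotonically_shrinking (V : finType) (G : temporal_graph V) : Prop :=
  forall t, 0 < t -> edges G t.+1 \subset edges G t.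

(* [F] is the edge set of a cycle visiting every vertex of [V] exactly once,
   in the cyclic order given by [c]. *)
Definition is_cycle (V : finType) (F : {set V} -> Prop) : Prop :=
  exists c : seq V,
    [/\ uniq c, 3 <= size c, (forall v, v \in c) &
        forall e, F e <-> exists v, e = [set v; next c v]].

Definition temporal_cycle (V : finType) (G : temporal_graph V) : Prop :=
  is_cycle (underlying_edge G).

Inductive player := Player1 | Player2.

Inductive status := Uncolored | Color of player | Gray.

Definition has_color (i : player) (s : status) : bool :=
  match i, s with
  | Player1, Color Player1 | Player2, Color Player2 => true
  | _, _ => false
  end.

Section Diffusion.
Variables (V : finType) (G : temporal_graph V).

Definition adjacent (t : nat) (v w : V) : bool := [set v; w] \in edges G t.

Definition initial_coloring (p1 p2 : V) (v : V) : status :=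
  if p1 == p2 then (if v == p1 then Gray else Uncolored)
  else if v == p1 then Color Player1
  else if v == p2 then Color Player2
  else Uncolored.

Definition diffusion_step (t : nat) (c : V -> status) (v : V) : status :=
  let sees i := [exists w, adjacent t v w && has_color i (c w)] in
  match c v with
  | Uncolored =>
      match sees Player1, sees Player2 with
      | true, false => Color Player1
      | false, true => Color Player2
      | true, true => Gray
      | false, false => Uncolored
      end
  | s => s
  end.

(* The coloring after step [t]; step [t] uses layer [t]. *)
Fixpoint coloring (p1 p2 : V) (t : nat) : V -> status :=
  match t with
  | 0 => initial_coloring p1 p2
  | s.+1 => diffusion_step s.+1 (coloring p1 p2 s)
  end.

(* Colors never change, so a vertex finally has color [i] iff it has color [i]
   at some time. *)
Definition payoff (i : player) (p1 p2 : V) : nat :=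
  #|[set v | `[< exists t, has_color i (coloring p1 p2 t v) >]]|.

Definition nash_equilibrium (p1 p2 : V) : Prop :=
  (forall q, payoff Player1 q p2 <= payoff Player1 p1 p2) /\
  (forall q, payoff Player2 p1 q <= payoff Player2 p1 p2).

End Diffusion.

(* Main.v *)
Require Import Defs.
From mathcomp Require Import all_boot.
From mathcomp Require Import boolp.

(* The witness is the cycle on 0, ..., 6 whose edges {0,1}, {1,2} and {2,3}
   disappear after the first layer; it was found by exhaustive search over
   small cycles.  Every diffusion process on it is stationary after 5 steps, so
   the payoffs are those of a finite simulation, and inspecting the 49 profiles
   shows that each of them admits an improving deviation. *)

Set Implicit Arguments.
Unset Strict Implicit.
Unset Printing Implicit Defensive.

Section Stationary.
Variables (V : finType) (G : temporal_graph V) (p q : V).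

Lemma has_color_coloringS i t v :
  has_color i (coloring G p q t v) -> has_color i (coloring G p q t.+1 v).
Proof. by rewrite /= /diffusion_step; case: (coloring G p q t v) => //; case: i. Qed.

Lemma has_color_coloring_le i s t v : s <= t ->
  has_color i (coloring G p q s v) -> has_color i (coloring G p q t v).
Proof.
move=> /subnK <-; elim: (t - s) => // k IHk colv.
by rewrite addSn; apply: has_color_coloringS; apply: IHk.
Qed.

(** Colors persist, so one taken before [T] is still there at [T], and from [T] on nothing changes.
    This trades the existential over all times for a single coloring. *)
Lemma payoff_stationary T i :
  (forall t, T <= t -> coloring G p q t =1 coloring G p q T) ->
  payoff G i p q = #|[set v | has_color i (coloring G p q T v)]|.
Proof.
move=> stat; apply: eq_card => v; rewrite !inE.
apply/asboolP/idP => [[t]|colv]; last by exists T.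
case/orP: (leq_total t T) => [|leTt]; first exact: has_color_coloring_le.
by rewrite stat.
Qed.

End Stationary.

(* [kept t i] says that the edge {i, i + 1 mod 7} is present in layer [t]. *)
Definition kept (t i : nat) : bool := (t <= 1) || (3 <= i).

Definition ring7_edges (t : nat) : {set {set 'I_7}} :=
  [set [set i; ordS i] | i : 'I_7 & kept t i].

Lemma ordS_neq (i : 'I_7) : i != ordS i.
Proof. by case: i; do 7?[case=> //]. Qed.

Lemma ring7_edges_card2 t e : e \in ring7_edges t -> #|e| = 2.
Proof. by case/imsetP => i _ ->; rewrite cards2 ordS_neq. Qed.

Definition ring7 : temporal_graph 'I_7 := TemporalGraph ring7_edges_card2.

Lemma ring7_cycle : temporal_cycle ring7.
Proof.
have nextE (v : 'I_7) : next (enum 'I_7) v = ordS v.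
  apply: val_inj; rewrite -(next_map val_inj) ?enum_uniq // val_enum_ord.
  by case: v; do 7?[case=> //].
exists (enum 'I_7); split=> [||v|e]; rewrite ?enum_uniq ?size_enum_ord ?mem_enum //.
split=> [[t _ /imsetP[i _ ->]]|[v ->]]; first by exists i; rewrite nextE.
(* Layer 1 contains all seven edges, so it alone yields the whole cycle. *)
by exists 1 => //; rewrite nextE; apply: imset_f; rewrite inE.
Qed.

Lemma ring7_shrinking : monotonically_shrinking ring7.
Proof.
move=> t t_gt0; apply: imsetS; apply/subsetP => i; rewrite !inE /kept.
by case: t t_gt0 => [|[|t]].
Qed.

(** Adjacency as arithmetic on [nat], so that [vm_compute] never meets finite sets. *)
Definition adj7 (t v w : nat) : bool :=
  kept t v && (w == v.+1 %% 7) || kept t w && (v == w.+1 %% 7).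

Lemma adjacent_ring7 t (v w : 'I_7) : adjacent ring7 t v w = adj7 t v w.
Proof.
rewrite /adjacent /adj7; apply/imsetP/orP; last first.
  case=> /andP[kept_i /eqP succ]; [exists v | exists w]; rewrite ?inE //.
    by congr [set v; _]; apply: val_inj.
  by rewrite setUC; congr [set w; _]; apply: val_inj.
case=> i; rewrite inE => kept_i eq_vw.
(* Comparing cardinalities excludes that [v] and [w] are the same end of the edge. *)
have neq_vw: v != w.
  by have := congr1 (fun A : {set 'I_7} => #|A|) eq_vw; rewrite !cards2 ordS_neq; case: eqP.
have [] : v \in [set i; ordS i] /\ w \in [set i; ordS i].
  by rewrite -eq_vw !inE !eqxx orbT.
rewrite !inE => /orP[]/eqP ev /orP[]/eqP ew; rewrite ev ew ?eqxx // in neq_vw *.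
- by left; rewrite kept_i /=.
- by right; rewrite kept_i /=.
Qed.

Lemma ring7_lifetime : is_lifetime ring7 2.
Proof.
split=> [|[|[|s]] [] // _ stable].
  split=> // t t_ge2; rewrite /= /ring7_edges (_ : kept t = kept 2) //.
  by apply: funext => i; rewrite /kept leqNgt t_ge2.
(* Only stability from layer 1 is left to refute: the edge {0,1} is in layer 1 but not in layer
   2. *)
have := adjacent_ring7 2 ord0 (ordS ord0).
by rewrite /adjacent stable // -/(adjacent _ _ _ _) adjacent_ring7.
Qed.

Definition sim_init (p q : nat) : seq status :=
  mkseq (fun v => if p == q then (if v == p then Gray else Uncolored)
                  else if v == p then Color Player1
                  else if v == q then Color Player2
                  else Uncolored) 7.

Definition sim_step (t : nat) (c : seq status) : seq status :=
  let sees v i :=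
    has (fun w => adj7 t v w && has_color i (nth Uncolored c w)) (iota 0 7) in
  mkseq (fun v =>
    match nth Uncolored c v with
    | Uncolored =>
        match sees v Player1, sees v Player2 with
        | true, false => Color Player1
        | false, true => Color Player2
        | true, true => Gray
        | false, false => Uncolored
        end
    | s => s
    end) 7.

Fixpoint sim (p q t : nat) : seq status :=
  if t is s.+1 then sim_step t (sim p q s) else sim_init p q.

Lemma coloring_sim (p q : 'I_7) t (v : 'I_7) :
  coloring ring7 p q t v = nth Uncolored (sim p q t) v.
Proof.
elim: t v => [|t IHt] v; first by rewrite [RHS]nth_mkseq.
rewrite [RHS]nth_mkseq //= /diffusion_step IHt.
suff seesE i : [exists w, adjacent ring7 t.+1 v w && has_color i (coloring ring7 p q t w)]
    = has (fun w => adj7 t.+1 v w && has_color i (nth Uncolored (sim p q t) w)) (iota 0 7).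
  by rewrite !seesE.
apply/existsP/hasP => [[w]|[w]].
  by rewrite adjacent_ring7 IHt; exists (val w); rewrite ?mem_iota ?ltn_ord.
rewrite mem_iota => /andP[_ w_lt7] ?; exists (Ordinal w_lt7).
by rewrite adjacent_ring7 IHt.
Qed.

Lemma forall2_lt7 (P : nat -> nat -> bool) :
  all (fun p => all (P p) (iota 0 7)) (iota 0 7) -> forall p q : 'I_7, P p q.
Proof. by move=> /allP allP' p q; apply: (allP (allP' p _)); rewrite mem_iota ltn_ord. Qed.

(** An injection into [nat] makes equality of simulated colorings a boolean test. *)
Definition status_code (s : status) : nat :=
  match s with
  | Uncolored => 0 | Color Player1 => 1 | Color Player2 => 2 | Gray => 3
  end.

Lemma status_code_inj : injective status_code.
Proof. by do 2?[case=> [|[]|]]. Qed.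

Lemma sim_stationary (p q : 'I_7) t : 5 <= t -> sim p q t = sim p q 5.
Proof.
move=> /subnK <-; elim: (t - 5) => // k IHk; rewrite addSn [LHS]/= IHk.
(* All layers from 2 on coincide, so it suffices that the state after 5 steps is a fixed point of
   the step with layer 2, which is a finite check. *)
rewrite -[RHS](_ : sim_step 2 (sim p q 5) = _).
  by rewrite /sim_step /adj7 /kept addnC.
apply: (inj_map status_code_inj); apply/eqP; move: p q {IHk}.
apply: (forall2_lt7 (P := fun p q =>
  map status_code (sim_step 2 (sim p q 5)) == map status_code (sim p q 5))).
by vm_compute.
Qed.

Definition sim_payoff (i : player) (p q : nat) : nat :=
  count (has_color i) (sim p q 5).

Lemma payoff_sim i (p q : 'I_7) : payoff ring7 i p q = sim_payoff i p q.
Proof.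
rewrite (@payoff_stationary _ _ _ _ 5) => [|t t_ge5 v]; last first.
  by rewrite !coloring_sim sim_stationary.
(* Viewing the list as the table of its own entries turns [count] into a sum over positions, hence
   over ['I_7]. *)
rewrite /sim_payoff -[sim p q 5](mkseq_nth Uncolored) count_map size_mkseq.
rewrite -sum1_count -[iota 0 7]/(index_iota 0 7) big_mkord -sum1_card.
by apply: eq_bigl => v; rewrite inE coloring_sim.
Qed.

Lemma ring7_improving (p q : 'I_7) :
  has (fun r => (sim_payoff Player1 p q < sim_payoff Player1 r q)
             || (sim_payoff Player2 p q < sim_payoff Player2 p r)) (iota 0 7).
Proof.
apply: (forall2_lt7 (P := fun p q => has (fun r =>
     (sim_payoff Player1 p q < sim_payoff Player1 r q)
  || (sim_payoff Player2 p q < sim_payoff Player2 p r)) (iota 0 7))).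
by vm_compute.
Qed.

Theorem theorem6 :
  exists (V : finType) (C : temporal_graph V),
    [/\ temporal_cycle C, monotonically_shrinking C, is_lifetime C 2 &
        ~ exists p1 p2 : V, nash_equilibrium C p1 p2].
Proof.
exists 'I_7, ring7; split.
- exact: ring7_cycle.
- exact: ring7_shrinking.
- exact: ring7_lifetime.
case=> p [q [best1 best2]].
have /hasP[r] := ring7_improving p q.
rewrite mem_iota => /andP[_ r_lt7].
have := best1 (Ordinal r_lt7); have := best2 (Ordinal r_lt7).
by rewrite !payoff_sim => ? ? /orP[]; rewrite ltnNge => /negP.
Qed.
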